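(* For every integer $n\geq 6$, $\sigma^{-}(C_n^{2})=6$.
   Context: $C_n$ denotes the cycle on $n$ vertices $u_0,\dots,u_{n-1}$, and $C_n^2$ is its square: the graph on the same vertices in which $u_i$ is adjacent to $u_{i\pm1}$ and $u_{i\pm2}$ (indices mod $n$). For a graph $G$ on $n$ vertices, the rna number $\sigma^{-}(G)$ is the minimum, over all partitions $V(G)=A\cup B$ with $A\cap B=\emptyset$ and $||A|-|B||\leq 1$, of the number of edges of $G$ with one endpoint in $A$ and the other in $B$ (equivalently, the least number of negative edges among all parity signed graphs over $G$). *)

(* Defs.v *)
From mathcomp Require Import all_boot.

Set Implicit Arguments.
Unset Strict Implicit.
Unset Printing Implicit Defensive.

Record sgraph := SGraph {
  vertex :> finType;
  adj : rel vertex;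
  adj_sym : symmetric adj;
  adj_irr : irreflexive adj }.

Section RnaNumber.

Variable G : sgraph.
Implicit Types A B : {set G}.

(* An edge is the unordered pair of its endpoints, so each edge counts once. *)
Definition edges : {set {set G}} :=
  [set E | [exists x : G, exists y : G, adj x y && (E == [set x; y])]].

Definition cut_edges A B : {set {set G}} :=
  [set E in edges | [exists x in A, exists y in B, E == [set x; y]]].

Definition balanced_partition A B : bool :=
  [&& A :|: B == [set: G], A :&: B == set0,
      #|A| <= #|B| + 1 & #|B| <= #|A| + 1].

Definition is_cut_size (k : nat) : bool :=
  [exists A : {set G}, exists B : {set G},
     balanced_partition A B && (#|cut_edges A B| == k)].

Lemma ex_cut_size : exists k, is_cut_size k.
Proof.
pose A : {set G} := [set x in take #|G|./2 (enum G)].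
exists #|cut_edges A (~: A)|.
apply/existsP; exists A; apply/existsP; exists (~: A); rewrite eqxx andbT.
have cA : #|A| = #|G|./2.
  rewrite cardsE (card_uniqP _) ?take_uniq ?enum_uniq //.
  by rewrite size_takel // -cardE -divn2 leq_div.
have cC : #|~: A| = odd #|G| + #|G|./2.
  apply: (@addnI #|A|); rewrite cardsC cA addnCA addnn.
  by rewrite odd_double_half.
rewrite /balanced_partition setUCr setICr !eqxx cA cC /=.
by case: (odd _); rewrite /= ?add0n ?add1n !addn1 ?leqnn ?leqnSn ?andbT ?leqW.
Qed.

Definition rna_number : nat := ex_minn ex_cut_size.

End RnaNumber.

(* The conjunct [i != j] only matters for n <= 2, where i + 1 or i + 2 can be
   congruent to i. *)
Definition cycle_sq_adj (n : nat) : rel 'I_n := fun i j =>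
  (i != j) &&
  [|| j == i + 1 %[mod n], i == j + 1 %[mod n],
      j == i + 2 %[mod n] | i == j + 2 %[mod n]].

Lemma cycle_sq_adj_sym n : symmetric (@cycle_sq_adj n).
Proof.
move=> i j; rewrite /cycle_sq_adj eq_sym; congr (_ && _).
by rewrite orbCA; congr [|| _, _ | _]; rewrite orbC.
Qed.

Lemma cycle_sq_adj_irr n : irreflexive (@cycle_sq_adj n).
Proof. by move=> i; rewrite /cycle_sq_adj eqxx. Qed.

Definition cycle_sq (n : nat) : sgraph :=
  SGraph (@cycle_sq_adj_sym n) (@cycle_sq_adj_irr n).

(* Main.v *)
Require Import Defs.
From mathcomp Require Import all_boot.
From mathcomp Require Import zify.

Set Implicit Arguments.
Unset Strict Implicit.
Unset Printing Implicit Defensive.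

Local Arguments ordS {n} i.

(** Let [f] be the indicator of [A] and [d i := f i (+) f (i + 1)].  The cut has
    [c1 + c2] edges, where [c1] counts the [i] with [d i] and [c2] those with
    [f i (+) f (i + 2)], that is with [d i (+) d (i + 1)].  Summing
    [(a (+) b) + 2 (a && b) = a + b] around the cycle shows that [c1] and [c2]
    are even, and positive as soon as [f] and [d] are not constant.  The only
    way to stay below 6 is [c1 = c2 = 2]; then the two changes of [f] are
    consecutive, so one side of the partition is a single vertex.  The half
    arcs have [c1 = 2], hence [c2 <= 4]. *)

Lemma val_iter_ordS n k (i : 'I_n) : iter k ordS i = (i + k) %% n :> nat.
Proof.
elim: k => [|k IH]; first by rewrite addn0 modn_small.
by rewrite iterS /= IH -addn1 modnDml addn1 addnS.
Qed.

Lemma iter_ordS_neq n k (i : 'I_n) : 0 < k < n -> iter k ordS i != i.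
Proof.
move=> /andP[k0 kn]; apply/negP => /eqP /(congr1 val) /=.
rewrite val_iter_ordS => /eqP.
rewrite -[X in _ == X](modn_small (ltn_ord i)) -[X in _ == X %% _]addn0 eqn_modDl.
by rewrite mod0n modn_small // => /eqP k00; rewrite k00 in k0.
Qed.

Lemma iter_ordS_surj n (i j : 'I_n) : exists k, j = iter k ordS i.
Proof.
exists (n - i + j); apply: val_inj.
rewrite /= val_iter_ordS addnA subnKC ?modnDl ?modn_small //.
exact: ltnW.
Qed.

Lemma eq_set2 (T : finType) (x y z t : T) :
  [set x; y] = [set z; t] -> (x = z /\ y = t) \/ (x = t /\ y = z).
Proof.
move=> E.
have : (x \in [set z; t]) && (y \in [set z; t]) by rewrite -E set21 set22.
have : (z \in [set x; y]) && (t \in [set x; y]) by rewrite E set21 set22.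
rewrite !in_set2 => /andP[/pred2P zxy /pred2P txy] /andP[/pred2P xzt /pred2P yzt].
by case: xzt yzt zxy txy => -> [] -> [] ? [] ?; subst; auto.
Qed.

Lemma ordS_invariant_const n (g : 'I_n -> bool) :
  (forall i, g (ordS i) = g i) -> forall i j, g i = g j.
Proof.
move=> gS i j; have [k ->] := iter_ordS_surj i j.
by elim: k => //= k IH; rewrite gS.
Qed.

Lemma sum_changes n (g : 'I_n -> bool) :
  \sum_i (g i (+) g (ordS i) : nat) + (\sum_i (g i && g (ordS i) : nat)).*2
  = (\sum_i (g i : nat)).*2.
Proof.
have SE : \sum_i (g i : nat) = \sum_i (g (ordS i) : nat).
  exact: reindex_inj (@ordS_inj n).
rewrite -[RHS]addnn {2}SE -addnn addnA -!big_split /=.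
by apply: eq_bigr => i _; case: (g i); case: (g _).
Qed.

Section CycleSquareCut.

Variable n : nat.
Hypothesis n6 : 6 <= n.

Definition chord k (i : 'I_n) : {set 'I_n} := [set i; iter k ordS i].

Lemma chord_inj k : 0 < k.*2 < n -> injective (chord k).
Proof.
move=> kn i j /eq_set2[[]//|[ij ji]].
by have := iter_ordS_neq j kn; rewrite -addnn iterD -ij ji eqxx.
Qed.

Lemma chord1_neq_chord2 i j : chord 1 i != chord 2 j.
Proof.
have neq k (x : 'I_n) : 0 < k < 6 -> iter k ordS x = x -> False.
  by move=> k6; apply/eqP/iter_ordS_neq; lia.
apply/eqP => /eq_set2[[-> /= /esym]|[-> /=]]; first exact: (neq 1).
exact: (neq 3).
Qed.

Lemma cycle_sq_adjE (i j : 'I_n) : cycle_sq_adj i j =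
  [|| j == iter 1 ordS i, i == iter 1 ordS j, j == iter 2 ordS i | i == iter 2 ordS j].
Proof.
have modE (k : nat) (x y : 'I_n) : (y == x + k %[mod n]) = (y == iter k ordS x).
  by rewrite -val_eqE /= val_iter_ordS (modn_small (ltn_ord y)).
rewrite /cycle_sq_adj !modE; case: eqVneq => [->|//] /=.
have h k : 0 < k < n -> (j == iter k ordS j) = false.
  by rewrite eq_sym => /iter_ordS_neq/negPf.
by rewrite (h 1) ?(h 2) //; lia.
Qed.

Definition changes k (f : 'I_n -> bool) : {set 'I_n} :=
  [set i | f i (+) f (iter k ordS i)].

Lemma card_changes k f :
  #|changes k f| = \sum_i (f i (+) f (iter k ordS i) : nat).
Proof. by rewrite -sum1dep_card big_mkcond; apply: eq_bigr => i _; case: (_ (+) _). Qed.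

Lemma cut_edges_cycle_sq (A : {set 'I_n}) :
  @cut_edges (cycle_sq n) A (~: A) =
  chord 1 @: changes 1 (mem A) :|: chord 2 @: changes 2 (mem A).
Proof.
apply/setP => E; rewrite inE; apply/andP/idP.
  move=> [+ /existsP[x /andP[xA /existsP[y /andP[+ /eqP EE]]]]].
  rewrite !inE => /existsP[z /existsP[t /andP[adjzt /eqP Ezt]]] yA.
  have : cycle_sq_adj x y.
    by move: Ezt; rewrite EE => /eq_set2[[-> ->]//|[-> ->]]; rewrite cycle_sq_adj_sym.
  rewrite cycle_sq_adjE EE => /or4P[]/eqP xy; apply/orP.
  - by left; apply/imsetP; exists x; rewrite ?inE /chord -?xy //= xA (negPf yA).
  - by left; apply/imsetP; exists y; rewrite ?inE /chord -?xy 1?setUC //= xA (negPf yA).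
  - by right; apply/imsetP; exists x; rewrite ?inE /chord -?xy //= xA (negPf yA).
  - by right; apply/imsetP; exists y; rewrite ?inE /chord -?xy 1?setUC //= xA (negPf yA).
have cutP k i : (k == 1) || (k == 2) -> i \in changes k (mem A) ->
    E = chord k i -> E \in @edges (cycle_sq n) /\
    [exists x in A, exists y in ~: A, E == [set x; y]].
  move=> k12; rewrite inE => fi ->; split.
    rewrite inE; apply/existsP; exists i; apply/existsP; exists (iter k ordS i).
    rewrite eqxx andbT [adj _ _]cycle_sq_adjE.
    by case/orP: k12 => /eqP->; rewrite eqxx ?orbT.
  move: fi => /=; case: (boolP (i \in A)) => iA /=.
    move=> jA; apply/existsP; exists i; rewrite iA; apply/existsP.
    by exists (iter k ordS i); rewrite inE jA eqxx.
  move=> jA; apply/existsP; exists (iter k ordS i); rewrite jA; apply/existsP.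
  by exists i; rewrite inE iA [chord _ _]setUC eqxx.
by rewrite inE => /orP[]/imsetP[i]; apply: cutP.
Qed.

Lemma card_cut_edges_cycle_sq (A : {set 'I_n}) :
  #|@cut_edges (cycle_sq n) A (~: A)| =
  #|changes 1 (mem A)| + #|changes 2 (mem A)|.
Proof.
rewrite cut_edges_cycle_sq cardsU !card_imset; try by apply: chord_inj; lia.
rewrite [X in #|pred_of_set X|](_ : _ :&: _ = set0) ?cards0 ?subn0 //.
apply/setP => E; rewrite !inE; apply/negP => /andP[/imsetP[i _ ->] /imsetP[j _]].
by move/eqP; apply/negP/chord1_neq_chord2.
Qed.

Lemma card_changes1 f : ~~ odd #|changes 1 f|.
Proof. by move: (sum_changes f); rewrite card_changes /=; lia. Qed.

Lemma card_changes2 f :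
  #|changes 2 f| + (\sum_i ((i \in changes 1 f) && (ordS i \in changes 1 f) : nat)).*2
  = #|changes 1 f|.*2.
Proof.
rewrite [#|changes 1 f|]card_changes -(sum_changes (fun i => f i (+) f (ordS i))).
congr (_ + _.*2).
  by rewrite card_changes; apply: eq_bigr => i _ /=; rewrite addbA addbK.
by apply: eq_bigr => i _; rewrite !inE.
Qed.

Lemma changes_eq0 k f : #|changes k f| = 0 -> forall i, f (iter k ordS i) = f i.
Proof.
move=> /eqP; rewrite cards_eq0 => /eqP/setP c i.
by have := c i; rewrite !inE; case: (f i); case: (f _).
Qed.

Lemma changes_lower_bound (f : 'I_n -> bool) (x1 x2 y1 y2 : 'I_n) :
  x1 != x2 -> y1 != y2 -> f x1 -> f x2 -> ~~ f y1 -> ~~ f y2 ->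
  6 <= #|changes 1 f| + #|changes 2 f|.
Proof.
move=> x12 y12 fx1 fx2 fy1 fy2.
have odd1 := card_changes1 f; have c2E := card_changes2 f.
have c1_gt0 : 0 < #|changes 1 f|.
  rewrite lt0n; apply/eqP => /changes_eq0 /ordS_invariant_const /(_ x1 y1).
  by rewrite fx1 (negPf fy1).
have c2_gt0 : #|changes 1 f| < 6 -> 0 < #|changes 2 f|.
  move=> c1_lt6; rewrite lt0n; apply/eqP => /changes_eq0 f2.
  have dS i : (ordS i \in changes 1 f) = (i \in changes 1 f).
    by rewrite !inE /= [f (ordS (ordS i))]f2 addbC.
  have dconst := ordS_invariant_const dS.
  have /card_gt0P[i di] := c1_gt0.
  suff cT : changes 1 f = setT by move: c1_lt6; rewrite cT cardsT card_ord; lia.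
  by apply/setP => j; rewrite in_setT; apply: etrans (dconst j i) di.
case: (ltnP #|changes 1 f| 6) => [c1_lt6|]; last by lia.
have {c2_gt0} c2_gt0 := c2_gt0 c1_lt6.
case: (eqVneq #|changes 1 f| 2) => [c1_2|]; last by lia.
case: (posnP (\sum_i ((i \in changes 1 f) && (ordS i \in changes 1 f) : nat)));
  first by lia.
rewrite lt0n sum_nat_eq0 negb_forall => /existsP[i /=].
rewrite eqb0 negbK => /andP[di dSi].
have iS : i != ordS i by rewrite eq_sym; apply: (@iter_ordS_neq n 1); lia.
have cE : [set i; ordS i] = changes 1 f.
  apply/eqP; rewrite eqEcard cards2 iS c1_2 leqnn andbT.
  by apply/subsetP => j; rewrite in_set2 => /orP[]/eqP->.
(* Flipping [f] at the vertex between the two changes makes it constant. *)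
have /ordS_invariant_const gconst j :
    f (ordS j) (+) (ordS j == ordS i) = f j (+) (j == ordS i).
  rewrite (inj_eq (@ordS_inj n)).
  have /setP/(_ j) := cE; rewrite !inE /=.
  case: (eqVneq j i) => [->|ji]; first by rewrite (negPf iS); case: (f i); case: (f _).
  by case: (j == ordS i); case: (f j); case: (f _).
have one j k : j != k -> f j = f k -> f j = ~~ f (ordS i).
  move=> jk fjk; have := gconst j k; have := gconst j (ordS i); rewrite eqxx.
  case: (eqVneq j (ordS i)) => [ji|_]; last by rewrite addbF addbT.
  by rewrite -{2}ji [k == _]eq_sym (negPf jk) -fjk; case: (f j).
have := one _ _ x12; have := one _ _ y12.
by rewrite fx1 fx2 (negPf fy1) (negPf fy2) => /(_ erefl) + /(_ erefl); case: (f _).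
Qed.

Lemma balanced_cut_lower_bound (A B : {set 'I_n}) :
  @balanced_partition (cycle_sq n) A B -> 6 <= #|@cut_edges (cycle_sq n) A B|.
Proof.
case/and4P => /eqP AUB /eqP AIB AB BA.
have BE : B = ~: A.
  apply/setP => x; have /setP/(_ x) := AUB; have /setP/(_ x) := AIB.
  by rewrite !inE; case: (x \in A); case: (x \in B).
have := cardsC A; rewrite -BE card_ord => sAB.
have [A1 B1] : 1 < #|A| /\ 1 < #|B|.
  have {}AB : #|A| <= #|B| + 1 := AB; have {}BA : #|B| <= #|A| + 1 := BA; lia.
have /card_gt1P[x1 [x2 [x1A x2A x12]]] := A1.
have /card_gt1P[y1 [y2 [+ + y12]]] := B1.
rewrite BE !inE card_cut_edges_cycle_sq => y1A y2A.
exact: changes_lower_bound x12 y12 x1A x2A y1A y2A.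
Qed.

Definition half_arc : {set 'I_n} := [set i : 'I_n | i < n./2].

Lemma card_half_arc : #|half_arc| = n./2.
Proof.
have hn : n./2 <= n by lia.
rewrite -sum1dep_card -(big_ord_widen n (fun=> 1) hn).
by rewrite sum1_card card_ord.
Qed.

Lemma half_arc_balanced : @balanced_partition (cycle_sq n) half_arc (~: half_arc).
Proof.
have cC : #|~: half_arc| = n - n./2 by rewrite cardsCs setCK card_ord card_half_arc.
by rewrite /balanced_partition setUCr setICr !eqxx /= card_half_arc cC; lia.
Qed.

Lemma half_arc_cut : #|@cut_edges (cycle_sq n) half_arc (~: half_arc)| <= 6.
Proof.
rewrite card_cut_edges_cycle_sq.
have := card_changes2 (mem half_arc).
suff : #|changes 1 (mem half_arc)| <= 2 by lia.
have h1 : n./2.-1 < n by lia.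
have h2 : n.-1 < n by lia.
have -> : 2 = #|[set Ordinal h1; Ordinal h2]|.
  by rewrite cards2 -val_eqE /=; lia.
apply/subset_leq_card/subsetP => i; rewrite !inE -!val_eqE /=.
have i_n := ltn_ord i.
case: (ltngtP i.+1 n) => [lt_in|gt_in|eq_in]; first rewrite modn_small //; lia.
Qed.

End CycleSquareCut.

Theorem theorem3p3 (n : nat) (hn : 6 <= n) : rna_number (cycle_sq n) = 6.
Proof.
rewrite /rna_number; case: ex_minnP => k.
case/existsP => A /existsP[B /andP[bal /eqP <-]] kmin.
apply/eqP; rewrite eqn_leq (balanced_cut_lower_bound hn) // andbT.
apply: leq_trans (half_arc_cut hn); apply: kmin.
apply/existsP; exists (half_arc n); apply/existsP; exists (~: half_arc n).
by rewrite half_arc_balanced ?eqxx.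
Qed.
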